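(* Let $\mu\in(0,1)$, $P_m\in(0,1)$, $\gamma_s>0$, $\chi^2>0$, $\sigma_u^2>0$, and let $N_s$ be a positive integer that is sufficiently large, in the sense that $\sqrt{N_s}>\mathcal Q^{-1}(P_m)$. For secondary transmit power $\sigma_s^2>0$ put $\gamma_i=\chi^2\sigma_s^2/\sigma_u^2$, $$P_f^0=\mathcal Q\left(-\mathcal Q^{-1}(P_m)(1+\gamma_s)+\gamma_s\sqrt{N_s}\right),$$ $$P_f^1=\mathcal Q\left(-\mathcal Q^{-1}(P_m)\left(1+\frac{\gamma_s}{1+\gamma_i}\right)+\frac{\gamma_s\sqrt{N_s}}{1+\gamma_i}\right),$$ $\xi=1-P_f^0+P_f^1$, and $$P_w=\frac{\mu}{2}+\frac{\left(\frac1\mu-1\right)P_f^1+1-P_m}{1+\left(\frac1\mu-1\right)\xi}.$$ Then, with all other parameters held fixed, the spectrum waste ratio $P_w$ is an increasing function of the secondary transmit power $\sigma_s^2\in(0,\infty)$.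
   Context: $\mathcal Q(x)=\frac{1}{\sqrt{2\pi}}\int_x^\infty e^{-t^2/2}\,dt$ is the complementary distribution function of the standard Gaussian and $\mathcal Q^{-1}$ its inverse. Interpretation: $\mu$ is the per-slot arrival probability of the primary user; $P_m$ is the common miss-detection probability of energy detection (whether the secondary user is silent or transmitting), fixed by the collision constraint; $P_f^0$ and $P_f^1$ are the false-alarm probabilities when the secondary user is silent or transmitting; $\gamma_s$ is the sensing SNR; $\gamma_i$ is the interference-to-noise ratio of the residual self-interference with suppression factor $\chi^2$ and noise variance $\sigma_u^2$; $N_s$ is the number of samples per slot. *)

(* Defs.v *)
From mathcomp Require Import all_boot all_order all_algebra.
From mathcomp Require Import all_classical all_reals all_analysis.

Set Implicit Arguments.
Unset Strict Implicit.
Unset Printing Implicit Defensive.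

Import Order.TTheory GRing.Theory Num.Theory.
Import numFieldNormedType.Exports.

Local Open Scope classical_set_scope.
Local Open Scope ring_scope.

Definition Q (R : realType) (x : R) : R :=
  (Num.sqrt (2 * pi))^-1 *
  \int[lebesgue_measure]_(t in `[x, +oo[) expR (- (t ^+ 2) / 2).

(* [Q] is a strictly decreasing bijection from R onto ]0, 1[, so for
   p in ]0, 1[ the chosen point is the only one with [Q x = p]; the default
   value 0 is only reached outside ]0, 1[. *)
Definition Qinv (R : realType) (p : R) : R := xget 0 [set x : R | Q x = p].

(* The squared quantities chi^2, sigma_u^2, sigma_s^2 are parameters in their
   own right and are written chi2, sigma_u2, sigma_s2. *)
Definition gamma_i (R : realType) (chi2 sigma_u2 sigma_s2 : R) : R :=
  chi2 * sigma_s2 / sigma_u2.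

Definition Pf0 (R : realType) (Pm gamma_s : R) (Ns : nat) : R :=
  Q (- Qinv Pm * (1 + gamma_s) + gamma_s * Num.sqrt Ns%:R).

Definition Pf1 (R : realType) (Pm gamma_s chi2 sigma_u2 : R) (Ns : nat)
    (sigma_s2 : R) : R :=
  let gi := gamma_i chi2 sigma_u2 sigma_s2 in
  Q (- Qinv Pm * (1 + gamma_s / (1 + gi))
     + gamma_s * Num.sqrt Ns%:R / (1 + gi)).

Definition xi (R : realType) (Pm gamma_s chi2 sigma_u2 : R) (Ns : nat)
    (sigma_s2 : R) : R :=
  1 - Pf0 Pm gamma_s Ns + Pf1 Pm gamma_s chi2 sigma_u2 Ns sigma_s2.

Definition Pw (R : realType) (mu Pm gamma_s chi2 sigma_u2 : R) (Ns : nat)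
    (sigma_s2 : R) : R :=
  mu / 2 +
  ((mu^-1 - 1) * Pf1 Pm gamma_s chi2 sigma_u2 Ns sigma_s2 + 1 - Pm) /
  (1 + (mu^-1 - 1) * xi Pm gamma_s chi2 sigma_u2 Ns sigma_s2).

(* Main.v *)
(* With q = Qinv Pm, the false-alarm probability [Pf1] is the value of Q at
   gamma_s (sqrt Ns - q) / (1 + gamma_i) - q, which decreases with the transmit
   power since sqrt Ns > q; as Q is decreasing, [Pf1] increases. In turn [Pw] is
   a homographic function of [Pf1], whose determinant has the sign of
   (1/mu - 1) (1 - Pf0) + Pm, positive because Pf0 <= 1. *)
Require Import Defs.
From mathcomp Require Import all_boot all_order all_algebra.
From mathcomp Require Import all_classical all_reals all_analysis.
From mathcomp Require Import ring lra.

Set Implicit Arguments.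
Unset Strict Implicit.
Unset Printing Implicit Defensive.

Import Order.TTheory GRing.Theory Num.Theory.
Import numFieldNormedType.Exports.

Local Open Scope classical_set_scope.
Local Open Scope ring_scope.

(** The integrand is the standard normal density divided by the constant [normal_peak 1], and that
    density is integrable on the whole line. *)
Lemma integrable_gaussian (R : realType) (A : set R) : measurable A ->
  lebesgue_measure.-integrable A
    (EFin \o (fun t : R => expR (- (t ^+ 2) / 2))).
Proof.
move=> mA; apply: (integrableS measurableT) => //.
rewrite (_ : _ \o _ =
    (fun t => (normal_peak 1)^-1%:E * (normal_pdf 0 1 t)%:E)%E); last first.
  apply/funext => t /=; rewrite normal_pdfE ?oner_neq0// -EFinM mulKf.
    by rewrite /normal_fun subr0 expr1n.
  by rewrite gt_eqF// normal_peak_gt0 ?oner_neq0.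
by apply: integrableZl => //; exact: integrable_normal_pdf.
Qed.

(** Seeing [Q] as the tail of a probability measure gives the bounds 0 and 1 at once. *)
Lemma Q_normal_prob (R : realType) (x : R) :
  Q x = fine (normal_prob 0 1 `[x, +oo[).
Proof.
rewrite /Q -RintegralZl//; last exact: integrable_gaussian.
congr fine; apply: eq_integral => t _.
rewrite normal_pdfE ?oner_neq0// /normal_peak /normal_fun.
by rewrite subr0 expr1n mul1r -[pi *+ 2]mulr_natl.
Qed.

Lemma Q_ge0 (R : realType) (x : R) : 0 <= Q x.
Proof. by rewrite Q_normal_prob fine_ge0. Qed.

Lemma Q_le1 (R : realType) (x : R) : Q x <= 1.
Proof.
rewrite Q_normal_prob -lee_fin fineK; first exact: probability_le1.
exact: fin_num_measure.
Qed.

Lemma Rintegral_gaussian_gt0 (R : realType) (x y : R) : x < y ->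
  0 < \int[lebesgue_measure]_(t in `[x, y]) expR (- (t ^+ 2) / 2).
Proof.
(* [m] is a positive lower bound of the integrand on [[x, y]]: there t^2 is at most y^2 if t >= 0
   and at most x^2 otherwise. *)
move=> xy; pose m := expR (- (x ^+ 2 + y ^+ 2) / 2).
apply: (@lt_le_trans _ _ (\int[lebesgue_measure]_(t in `[x, y]) m)).
  rewrite Rintegral_cst//= lebesgue_measure_itv/= lte_fin xy/=.
  by rewrite mulr_gt0 ?expR_gt0 ?subr_gt0.
apply: le_Rintegral => //.
- apply: continuous_compact_integrable; first exact: segment_compact.
  by apply: continuous_subspaceT => t; exact: cvg_cst.
- exact: integrable_gaussian.
- move=> t /=; rewrite in_itv/= => /andP[xt ty]; rewrite ler_expR.
  by have [t0|t0] := leP 0 t; nra.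
Qed.

Lemma Q_decreasing (R : realType) : {homo @Q R : x y /~ x < y}.
Proof.
move=> y x xy; rewrite /Q ltr_pM2l; last first.
  by rewrite invr_gt0 sqrtr_gt0 mulr_gt0 ?pi_gt0.
have itv_integrable (i : interval R) := integrable_gaussian (measurable_itv i).
(* Once its left endpoint is open, the tail beyond [y] is the integral over [[x, +oo[] minus the one
   over [[x, y]], which is positive. *)
rewrite -[ltLHS]Rintegral_itv_obnd_cbnd; last exact: itv_integrable.
rewrite -(@Rintegral_itvB _ _ (BLeft x)); last 3 first.
- exact: itv_integrable.
- by rewrite bnd_simp ltW.
- by [].
by rewrite ltrBlDr ltrDl Rintegral_gaussian_gt0.
Qed.

Lemma Pf1_increasing (R : realType) (Pm gamma_s chi2 sigma_u2 : R) (Ns : nat) :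
  0 < gamma_s -> 0 < chi2 -> 0 < sigma_u2 -> Qinv Pm < Num.sqrt Ns%:R ->
  {in `]0, +oo[ &,
    {homo Pf1 Pm gamma_s chi2 sigma_u2 Ns : s t / s < t}}.
Proof.
move=> gs0 c0 u0 qN s t; rewrite !in_itv/= !andbT => s0 t0 st.
apply: Q_decreasing.
have argE g : - Qinv Pm * (1 + gamma_s / (1 + g)) +
    gamma_s * Num.sqrt Ns%:R / (1 + g) =
    gamma_s * (Num.sqrt Ns%:R - Qinv Pm) * (1 + g)^-1 - Qinv Pm.
  by ring.
have gi_gt0 r : 0 < r -> 0 < 1 + gamma_i chi2 sigma_u2 r.
  by move=> r0; rewrite ltr_wpDr// divr_ge0 ?mulr_ge0 ?ltW.
rewrite !argE ltrD2r ltr_pM2l; last by rewrite mulr_gt0// subr_gt0.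
rewrite ltf_pV2 ?posrE ?gi_gt0// ltrD2l.
by rewrite /gamma_i ltr_pM2r ?invr_gt0// ltr_pM2l.
Qed.

(** Both denominators are positive, and the difference of the cross products factors as a (q - p) (1
    + a k - c). It is meant for a = 1/mu - 1, k = 1 - [Pf0], c = 1 - [Pm], with p and q two values
    of [Pf1]. *)
Lemma homographic_increasing (R : realFieldType) (a k c p q : R) :
  0 < a -> 0 <= k -> c < 1 + a * k -> 0 <= p -> p < q ->
  (a * p + c) / (1 + a * (k + p)) < (a * q + c) / (1 + a * (k + q)).
Proof.
move=> a0 k0 ck p0 pq.
have den_gt0 r : 0 <= r -> 0 < 1 + a * (k + r).
  by move=> r0; rewrite ltr_wpDr// mulr_ge0 ?addr_ge0// ltW.
have q0 : 0 <= q by exact: ltW (le_lt_trans p0 pq).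
rewrite ltr_pdivrMr ?den_gt0// mulrAC ltr_pdivlMr ?den_gt0// -subr_gt0.
have -> : (a * q + c) * (1 + a * (k + p)) - (a * p + c) * (1 + a * (k + q)) =
    a * (q - p) * (1 + a * k - c) by ring.
by rewrite !mulr_gt0 ?subr_gt0.
Qed.

Theorem proposition3 (R : realType) (mu Pm gamma_s chi2 sigma_u2 : R)
    (Ns : nat)
    (mu_gt0 : 0 < mu) (mu_lt1 : mu < 1)
    (Pm_gt0 : 0 < Pm) (Pm_lt1 : Pm < 1)
    (gamma_s_gt0 : 0 < gamma_s) (chi2_gt0 : 0 < chi2)
    (sigma_u2_gt0 : 0 < sigma_u2)
    (Ns_gt0 : (0 < Ns)%N) (Ns_large : Qinv Pm < Num.sqrt Ns%:R) :
  {in `]0, +oo[ &,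
    {homo Pw mu Pm gamma_s chi2 sigma_u2 Ns : s t / s < t}}.
Proof.
move=> s t s_in t_in st; rewrite /Pw /xi ltrD2l -!addrA.
have Pf0_le1 : 0 <= 1 - Pf0 Pm gamma_s Ns by rewrite subr_ge0 Q_le1.
have odds_gt0 : 0 < mu^-1 - 1 by rewrite subr_gt0 invf_gt1.
rewrite ![1 + (- _ + _)]addrA; apply: homographic_increasing => //.
(* The condition c < 1 + a k reads 1 - [Pm] < 1 + a (1 - [Pf0]); it is strict because [Pm] > 0. *)
- have := mulr_ge0 (ltW odds_gt0) Pf0_le1; lra.
- exact: Q_ge0.
- exact: Pf1_increasing.
Qed.
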